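(* Let $G_1=(V,E_1)$ and $G_2=(V,E_2)$ be two Markov equivalent directed acyclic graphs on the same set of nodes $V$. Then the model $\mathcal{N}_*(G_1)$ is generically finitely identifiable if and only if the model $\mathcal{N}_*(G_2)$ is generically finitely identifiable.
   Context: For a directed acyclic graph (DAG) $G=(V,E)$ with $V=\{1,\dots,m\}$, let $\mathbb{R}_E=\{\Lambda=(\lambda_{wv})\in\mathbb{R}^{m\times m}: w\to v\notin E\Rightarrow \lambda_{wv}=0\}$, let $\mathrm{diag}_m^+$ be the set of $m\times m$ diagonal matrices with positive diagonal, and let $\Theta=\mathbb{R}_E\times \mathrm{diag}_m^+\times\mathbb{R}^m$, regarded as an open subset of $\mathbb{R}^{2m+|E|}$. The model $\mathcal{N}_*(G)$ is the family of normal distributions $N_m(0,\Sigma)$ with $\Sigma$ in the image of $$\phi_G:\Theta\to\mathbb{R}^{m\times m},\qquad \phi_G(\Lambda,\Omega,\delta)=(I_m-\Lambda^T)^{-1}(\Omega+\delta\delta^T)(I_m-\Lambda)^{-1}.$$ An algebraic set in $\mathbb{R}^n$ is the common zero set of finitely many real polynomials; it is proper if it is not all of $\mathbb{R}^n$. A map $f$ defined on an open set $S\subset\mathbb{R}^n$ is generically finite-to-one if there is a proper algebraic set $\tilde S\subset\mathbb{R}^n$ such that for every $s\in S\setminus\tilde S$ the fiber $\{s'\in S: f(s')=f(s)\}$ is finite. The model $\mathcal{N}_*(G)$ is generically finitely identifiable if $\phi_G$ is generically finite-to-one on $\Theta$. Two DAGs on the same node set are Markov equivalent if they have the same d-separation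 relations. *)

(* Defs.v *)
From HB Require Import structures.
From mathcomp Require Import all_boot all_order all_algebra.
From mathcomp Require Import classical_sets functions cardinality reals.
From mathcomp Require Import mpoly.

Set Implicit Arguments.
Unset Strict Implicit.
Unset Printing Implicit Defensive.

Import GRing.Theory Num.Theory.

(* A directed graph on V = 'I_m is its edge set E : {set 'I_m * 'I_m};
   (w, v) \in E stands for w -> v. *)
Definition edge (m : nat) (E : {set 'I_m * 'I_m}) : rel 'I_m :=
  fun w v => (w, v) \in E.

Definition acyclic (m : nat) (E : {set 'I_m * 'I_m}) : Prop :=
  forall (v : 'I_m) (p : seq 'I_m), ~~ cycle (edge E) (v :: p).

Definition adjacent (m : nat) (E : {set 'I_m * 'I_m}) : rel 'I_m :=
  fun w v => edge E w v || edge E v w.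

Definition collider (m : nat) (E : {set 'I_m * 'I_m}) (u v w : 'I_m) : bool :=
  edge E u v && edge E w v.

(* In a DAG two nodes are joined by at most one edge, so a path is determined
   by its sequence of nodes. A collider is open when it lies in C or has a
   descendant in C; [connect (edge E) v c] includes the case v = c. *)
Definition open_at (m : nat) (E : {set 'I_m * 'I_m}) (C : {set 'I_m})
    (u v w : 'I_m) : bool :=
  if collider E u v w then [exists c in C, connect (edge E) v c]
  else v \notin C.

Definition d_connected (m : nat) (E : {set 'I_m * 'I_m}) (C : {set 'I_m})
    (x y : 'I_m) : Prop :=
  exists p : seq 'I_m,
    [/\ path (adjacent E) x p, uniq (x :: p), last x p = y &
        forall u v w, infix [:: u; v; w] (x :: p) -> open_at E C u v w].

Definition d_separated (m : nat) (E : {set 'I_m * 'I_m})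
    (A B C : {set 'I_m}) : Prop :=
  forall x y, x \in A -> y \in B -> ~ d_connected E C x y.

Definition markov_equivalent (m : nat) (E1 E2 : {set 'I_m * 'I_m}) : Prop :=
  forall A B C : {set 'I_m},
    [disjoint A & B] -> [disjoint A & C] -> [disjoint B & C] ->
    (d_separated E1 A B C <-> d_separated E2 A B C).

Local Open Scope classical_set_scope.
Local Open Scope ring_scope.

Definition algebraic_set (R : realType) (n : nat) (A : set 'rV[R]_n) : Prop :=
  exists ps : seq {mpoly R[n]},
    A = [set x | forall p, p \in ps -> p.@[x ord0] = 0].

Definition generically_finite_to_one (R : realType) (n : nat) (T : Type)
    (S : set 'rV[R]_n) (f : 'rV[R]_n -> T) : Prop :=
  exists S' : set 'rV[R]_n,
    [/\ algebraic_set S', S' <> setT &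
        forall s, (S `\` S') s -> finite_set [set s' | S s' /\ f s' = f s]].

(* Triples (Lambda, Omega, delta). *)
Definition params (R : realType) (m : nat) : Type :=
  ('M[R]_m * 'M[R]_m * 'cV[R]_m)%type.

Definition Theta (R : realType) (m : nat) (E : {set 'I_m * 'I_m}) :
    set (params R m) :=
  [set t : params R m |
    [/\ forall w v : 'I_m, (w, v) \notin E -> t.1.1 w v = 0,
        is_diag_mx t.1.2 & forall v : 'I_m, 0 < t.1.2 v v]].
Arguments Theta : clear implicits.

(* For acyclic E and Lambda in R_E the matrix I - Lambda is invertible, so
   invmx is the actual inverse on Theta. *)
Definition phi (R : realType) (m : nat) (t : params R m) : 'M[R]_m :=
  let: (Lambda, Omega, delta) := t in
  invmx (1%:M - Lambda^T) *m (Omega + delta *m delta^T) *m invmx (1%:M - Lambda).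

(* Coordinates on R_E x diag_m x R^m: the first m entries are the diagonal of
   Omega, the next m are delta, and the last #|E| are the edge weights. *)
Definition params_of_vec (R : realType) (m : nat) (E : {set 'I_m * 'I_m})
    (x : 'rV[R]_(m + m + #|E|)) : params R m :=
  (\sum_(k < #|E|) rsubmx x ord0 k *: delta_mx (enum_val k).1 (enum_val k).2,
   diag_mx (lsubmx (lsubmx x)),
   (rsubmx (lsubmx x))^T).

Definition Theta_vec (R : realType) (m : nat) (E : {set 'I_m * 'I_m}) :
    set 'rV[R]_(m + m + #|E|) :=
  [set x | Theta R m E (params_of_vec x)].
Arguments Theta_vec : clear implicits.

Lemma params_of_vec_edge (R : realType) (m : nat) (E : {set 'I_m * 'I_m})
    (x : 'rV[R]_(m + m + #|E|)) (k : 'I_#|E|) :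
  (params_of_vec x).1.1 (enum_val k).1 (enum_val k).2 = rsubmx x ord0 k.
Proof.
rewrite /= summxE (bigD1 k) //= !mxE !eqxx mulr1 big1 ?addr0 // => j njk.
rewrite !mxE; case: andP => [[/eqP e1 /eqP e2]|_]; last by rewrite mulr0.
case/eqP: njk; apply: enum_val_inj.
by rewrite [LHS]surjective_pairing -e1 -e2 -surjective_pairing.
Qed.

Lemma Theta_vec_bij (R : realType) (m : nat) (E : {set 'I_m * 'I_m}) :
  set_bij (Theta_vec R m E) (Theta R m E) (@params_of_vec R m E).
Proof.
split=> [x //|x y _ _ exy|[[L O] d] [/= L0 /is_diag_mxP Od Op]].
  rewrite -[x]hsubmxK -[y]hsubmxK -[lsubmx x]hsubmxK -[lsubmx y]hsubmxK.
  congr (row_mx (row_mx _ _) _).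
  - apply/rowP=> i; have := congr1 (fun t : params R m => t.1.2 i i) exy.
    by rewrite /= !mxE eqxx !mulr1n.
  - by have := congr1 (fun t : params R m => t.2) exy; apply: trmx_inj.
  - apply/rowP=> k; rewrite -(params_of_vec_edge x k) exy.
    exact: params_of_vec_edge.
pose x : 'rV[R]_(m + m + #|E|) :=
  row_mx (row_mx (\row_i O i i) d^T)
         (\row_k L (enum_val k).1 (enum_val k).2).
have px : params_of_vec x = (L, O, d).
  rewrite [LHS]surjective_pairing [X in (X, _)]surjective_pairing.
  congr (_, _, _).
  - apply/matrixP=> w v; have [wvE|wvE] := boolP ((w, v) \in E).
      have := params_of_vec_edge x (enum_rank_in wvE (w, v)).
      by rewrite enum_rankK_in //= => ->; rewrite row_mxKr mxE enum_rankK_in.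
    rewrite L0 //= summxE big1 // => k _; rewrite !mxE.
    case: andP => [[/eqP e1 /eqP e2]|_]; last by rewrite mulr0.
    by move: wvE; rewrite e1 e2 -surjective_pairing enum_valP.
  - rewrite /= row_mxKl row_mxKl; apply/matrixP=> i j; rewrite !mxE.
    by have [<-|nij] := eqVneq i j; rewrite ?mulr1n // mulr0n Od.
  - by rewrite /= row_mxKl row_mxKr trmxK.
exists x => //; rewrite /Theta_vec /= px; split=> //=.
by apply/is_diag_mxP.
Qed.

Definition generically_finitely_identifiable (R : realType) (m : nat)
    (E : {set 'I_m * 'I_m}) : Prop :=
  generically_finite_to_one (Theta_vec R m E)
    (fun x : 'rV[R]_(m + m + #|E|) => phi (params_of_vec x)).
Arguments generically_finitely_identifiable : clear implicits.

(* Main.v *)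
Require Import Defs.
From mathcomp Require Import boolp classical_sets functions cardinality.
From mathcomp Require Import all_boot all_order all_algebra reals.
From mathcomp Require Import mpoly ring.

(** Write [M] for the matrix [I - Lambda^T] of the structural equations
    [M X = delta L + eps]. If [P] is invertible, the equations [P M X = P delta
    L + P eps] describe the same vector [X], so [phi] does not change when
    [(M, Omega, delta)] becomes [(P M, P Omega P^T, P delta)]
    ([phi_mulmx]). When [x -> y] is a covered edge, that is, when [x] and [y]
    have the same parents apart from [x] itself, a suitable [P] acting on the
    rows [x] and [y] replaces the equations for [x] given the parents and for
    [y] given [x] and the parents by the equations for [y] given the parents
    and for [x] given [y] and the parents. The new noise matrix is again
    diagonal and positive, because the noise of a linear regression is
    uncorrelated with the regressors. This gives a map between the parameter
    spaces of the graph and of the graph in which [x -> y] is reversed, and the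
    same construction for [y -> x] is its inverse
    ([reverse_params_Theta], [reverse_params_phi], [reverse_paramsK]).

    The map is rational with denominators that do not vanish on the parameter
    space, so clearing denominators turns the polynomial that defines an
    exceptional set for one graph into such a polynomial for the other one, and
    generic finiteness is transported ([identifiable_reparametrize]).

    It remains to join Markov equivalent graphs by reversals of covered edges
    (Chickering). Markov equivalent acyclic graphs have the same skeleton and
    the same immoralities (Verma and Pearl), because the parents of a vertex
    separate it from each nonadjacent vertex that is not a descendant
    ([markov_skeleton], [markov_immoralities]). If two such graphs differ, then
    the first one has a covered edge that the second one reverses
    ([exists_covered_edge]); reversing it brings the two graphs closer. *)

Set Implicit Arguments.
Unset Strict Implicit.
Unset Printing Implicit Defensive.

(** * Acyclic graphs and d-separation *)

Definition topological m (E : {set 'I_m * 'I_m}) (r : 'I_m -> nat) :=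
  forall u v, edge E u v -> r u < r v.

Definition same_immoralities m (E F : {set 'I_m * 'I_m}) :=
  forall u v w, u != w -> ~~ adjacent E u w ->
  collider E u v w = collider F u v w.

Definition covered m (E : {set 'I_m * 'I_m}) (x y : 'I_m) :=
  edge E x y /\ forall z, z != x -> edge E z y = edge E z x.

Definition reversal m (E : {set 'I_m * 'I_m}) (x y : 'I_m) :=
  (y, x) |: E :\ (x, y).

Section Combinatorics.
Variable m : nat.
Implicit Types (E F : {set 'I_m * 'I_m}) (r : 'I_m -> nat) (x y : 'I_m).

(** The number of ancestors of a vertex increases along every edge. *)
Lemma acyclic_topological E : acyclic E -> exists r, topological E r.
Proof.
move=> acE; exists (fun v => #|[set w | connect (edge E) w v]|) => u v euv.
apply: proper_card; apply/properP; split.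
  apply/subsetP=> w; rewrite !inE => cwu.
  exact: connect_trans cwu (connect1 euv).
exists v; first by rewrite inE connect0.
rewrite inE; apply/negP=> /connectP[p pp lp].
by have := acE v p; rewrite /= rcons_path pp -lp euv.
Qed.

Lemma topological_acyclic E r : topological E r -> acyclic E.
Proof.
move=> rE v p; apply/negP=> /= cp.
have : path ltn (r v) (map r (rcons p v)).
  by rewrite path_map; apply: sub_path cp.
move/(order_path_min ltn_trans)/allP/(_ (r v)).
by rewrite map_f ?mem_rcons ?mem_head //= ltnn => /(_ isT).
Qed.

Lemma topological_connect E r u v :
  topological E r -> connect (edge E) u v -> r u <= r v.
Proof.
move=> rE /connectP[p]; elim: p u => [|w p IHp] u /=; first by move=> _ ->.
by case/andP=> /rE/ltnW ruw pp lp; exact: leq_trans ruw (IHp w pp lp).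
Qed.

Lemma topological_irr E r x : topological E r -> edge E x x = false.
Proof. by move=> rE; apply/negP=> /rE; rewrite ltnn. Qed.

Lemma topological_neq E r x y : topological E r -> edge E x y -> x != y.
Proof.
by move=> rE; apply: contraTneq => ->; rewrite (topological_irr _ rE).
Qed.

Lemma topological_asym E r u v :
  topological E r -> edge E u v -> edge E v u = false.
Proof. by move=> rE /rE ruv; apply/negP=> /rE; rewrite ltnNge ltnW. Qed.

Lemma adjacent_sym E x y : adjacent E x y = adjacent E y x.
Proof. by rewrite /adjacent orbC. Qed.

Lemma adjacent_d_connected E C x y :
  x != y -> adjacent E x y -> d_connected E C x y.
Proof.
move=> nxy axy; exists [:: y]; split; rewrite /= ?axy ?inE ?nxy //.
by move=> u v w; rewrite !andbF.
Qed.

Lemma d_connected_triple E C u v w :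
    u != w -> u != v -> v != w -> adjacent E u v -> adjacent E v w ->
    open_at E C u v w ->
  d_connected E C u w.
Proof.
move=> uw uv vw auv avw o; exists [:: v; w]; split=> //=; rewrite ?auv ?avw //.
  by rewrite !inE negb_or uv uw vw.
move=> a b c; rewrite /= !andbF !andbT !orbF.
by case/and3P=> /eqP-> /eqP-> /eqP->.
Qed.

(** A path that enters [x] through a parent is blocked there, because a parent
    of [x] lies in the conditioning set and is not a collider. A path that
    leaves [x] along an outgoing edge descends until it meets a collider, since
    [y] is not a descendant of [x]. That collider is a descendant of [x], hence
    not an ancestor of a parent of [x], and it is closed. *)
Lemma parents_d_separate E r x y :
    topological E r -> x != y -> ~~ adjacent E x y -> ~~ connect (edge E) x y ->
  ~ d_connected E [set z | edge E z x] x y.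
Proof.
move=> rE xy nxy ncxy [p [pp _ lp op]].
have desc q : forall u a, edge E u a -> connect (edge E) x u ->
    path (adjacent E) a q -> last a q = y ->
    (forall s t z, infix [:: s; t; z] (u :: a :: q) ->
       open_at E [set z | edge E z x] s t z) -> False.
  elim: q => [|w q IHq] u a eua cxu => [_ /= ea _|].
    by move: ncxy; rewrite -ea (connect_trans cxu (connect1 eua)).
  case/andP=> aaw pq lq oq.
  have cxa := connect_trans cxu (connect1 eua).
  have [eaw|neaw] := boolP (edge E a w).
    apply: (IHq a w) => // s t z h; apply: oq.
    by rewrite infix_consl h orbT.
  have ewa : edge E w a by move: aaw; rewrite /adjacent (negPf neaw).
  have := oq u a w (prefix_infix [:: u; a; w] q).
  rewrite /open_at /collider eua ewa => /existsP[c /andP[]].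
  rewrite inE => ecx /(topological_connect rE) rac.
  have := leq_ltn_trans rac (rE _ _ ecx).
  rewrite ltnNge => /negP[]; apply: leq_trans (ltnW (rE _ _ eua)).
  exact: topological_connect rE cxu.
case: p pp lp op => [_ /eqP|a q /andP[axa pq] lq oq].
  by rewrite (negPf xy).
have [exa|nexa] := boolP (edge E x a); first exact: (desc q x a).
have eax : edge E a x by move: axa; rewrite /adjacent (negPf nexa).
case: q pq lq oq => [_ ea _|w q _ _ oq].
  by move: nxy; rewrite /adjacent -ea eax orbT.
have := oq x a w (prefix_infix [:: x; a; w] q).
by rewrite /open_at /collider (negPf nexa) /= inE eax.
Qed.

Lemma markov_equivalentC E F : markov_equivalent E F -> markov_equivalent F E.
Proof. by move=> EF A B C dAB dAC dBC; rewrite EF. Qed.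

(** The parents of [x] form the separator. They separate [x] only from its
    nondescendants, but in an acyclic graph any two vertices can be named so
    that [y] is not a descendant of [x] ([not_connect_both]). *)
Lemma common_separator E F r x y :
    topological E r -> markov_equivalent E F -> x != y ->
    ~~ adjacent E x y -> ~~ connect (edge E) x y ->
  exists C : {set 'I_m}, ~ d_connected E C x y /\ ~ d_connected F C x y.
Proof.
move=> rE EF xy nxy ncxy; have sE := parents_d_separate rE xy nxy ncxy.
exists [set z | edge E z x]; split=> //.
have sep1 G C : d_separated G [set x] [set y] C <-> ~ d_connected G C x y.
  split=> [s|s u v /set1P-> /set1P-> //]; apply: s; exact: set11.
apply/sep1/EF; last exact/sep1.
- by rewrite disjoints1 inE.
- by rewrite disjoints1 inE (topological_irr _ rE).
- rewrite disjoints1 inE; apply: contra nxy => eyx.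
  by rewrite /adjacent eyx orbT.
Qed.

Lemma not_connect_both E r x y :
    topological E r -> x != y ->
  ~~ connect (edge E) x y \/ ~~ connect (edge E) y x.
Proof.
move=> rE xy; have [cxy|] := boolP (connect (edge E) x y); last by left.
right; apply/negP=> cyx.
case/connectP: cxy xy cyx => [[_ ->|z p /= /andP[exz pp] lp]].
  by rewrite eqxx.
move=> _ cyx; have := rE _ _ exz; rewrite ltnNge => /negP[].
apply: topological_connect rE _; apply: connect_trans cyx.
by apply/connectP; exists p.
Qed.

(** Adjacent vertices are d-connected given every set, so they cannot have the
    common separator of two vertices that [E] does not join. *)
Lemma markov_sub_skeleton E F r s :
    topological E r -> topological F s -> markov_equivalent E F ->
  forall x y, adjacent F x y -> adjacent E x y.
Proof.
move=> rE sF EF x y axy.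
have xy : x != y.
  apply: contraTneq axy => ->.
  by rewrite /adjacent (topological_irr _ sF).
wlog ncxy : x y axy xy / ~~ connect (edge E) x y => [hw|].
  case: (not_connect_both rE xy) => nc; first exact: hw.
  by rewrite adjacent_sym; apply: hw; rewrite // 1?adjacent_sym // eq_sym.
apply: contraT => naxy.
have [C [_ []]] := common_separator rE EF xy naxy ncxy.
exact: adjacent_d_connected.
Qed.

Lemma markov_skeleton E F r s :
    topological E r -> topological F s -> markov_equivalent E F ->
  adjacent E =2 adjacent F.
Proof.
move=> rE sF EF x y; apply/idP/idP.
  exact: markov_sub_skeleton sF rE (markov_equivalentC EF) x y.
exact: markov_sub_skeleton rE sF EF x y.
Qed.

(** Along [u - v - w], conditioning on [v] opens a collider and blocks a
    noncollider. If [v] were a collider in [F] only, then a set that separates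
    [u] from [w] in both graphs would have to contain [v] because of [E] and to
    avoid it because of [F]. *)
Lemma markov_sub_immorality E F r s u v w :
    topological E r -> topological F s -> markov_equivalent E F ->
  u != w -> ~~ adjacent E u w -> collider F u v w -> collider E u v w.
Proof.
move=> rE sF EF uw nuw cF.
wlog ncuw : u w uw nuw cF / ~~ connect (edge E) u w => [hw|].
  case: (not_connect_both rE uw) => nc; first exact: hw.
  rewrite /collider andbC; apply: hw; rewrite // 1?eq_sym // 1?adjacent_sym //.
  by rewrite /collider andbC.
have [C [sE sF']] := common_separator rE EF uw nuw ncuw.
have [euv ewv] := andP cF; have sk := markov_skeleton rE sF EF.
have auv : adjacent F u v by rewrite /adjacent euv.
have avw : adjacent F v w by rewrite /adjacent ewv orbT.
have uv := topological_neq sF euv.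
have vw : v != w by rewrite eq_sym (topological_neq sF ewv).
apply: contraT => ncE; case: sE.
apply: (d_connected_triple uw uv vw); rewrite ?sk // /open_at (negPf ncE).
apply/negP=> vC; apply: sF'; apply: (d_connected_triple uw uv vw) => //.
by rewrite /open_at cF; apply/existsP; exists v; rewrite vC connect0.
Qed.

Lemma markov_immoralities E F r s :
    topological E r -> topological F s -> markov_equivalent E F ->
  same_immoralities E F.
Proof.
move=> rE sF EF u v w uw nuw; apply/idP/idP.
  apply: (markov_sub_immorality sF rE (markov_equivalentC EF) uw).
  by rewrite -(markov_skeleton rE sF EF).
exact: markov_sub_immorality rE sF EF uw nuw.
Qed.

(** * Reversal of covered edges *)

Lemma edge_reversal E x y u v :
  edge (reversal E x y) u v =
    ((u, v) == (y, x)) || ((u, v) != (x, y)) && edge E u v.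
Proof. by rewrite /edge !inE. Qed.

Lemma reversal_topological E r x y :
    topological E r -> covered E x y ->
  exists r', topological (reversal E x y) r'.
Proof.
move=> rE [exy cov].
(* The vertex y moves to just before x, after all the common parents. *)
exists (fun v => if v == y then (r x).*2 else (r v).*2.+1) => u v.
have rxy := rE _ _ exy.
have nxy := negPf (topological_neq rE exy).
rewrite edge_reversal => /orP[/eqP[-> ->]|/andP[uv euv]].
  by rewrite eqxx nxy.
have [uy|uy] := eqVneq u y; have [vy|vy] := eqVneq v y.
- by move: euv; rewrite uy vy (topological_irr _ rE).
- have := rE _ _ euv; rewrite uy => ryv; rewrite ltnS leq_double.
  exact/ltnW/(ltn_trans rxy).
- have ux : u != x by apply: contraNneq uv => ->; rewrite vy.
  have /rE : edge E u x by rewrite -cov // -vy.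
  by rewrite ltn_Sdouble.
- by rewrite ltnS ltn_double; exact: rE.
Qed.

Lemma reversal_adjacent E x y :
  edge E x y -> adjacent (reversal E x y) =2 adjacent E.
Proof.
move=> exy u v.
have swap a b c d : ((a, b) == (c, d) :> 'I_m * 'I_m) = ((b, a) == (d, c)).
  by rewrite !xpair_eqE andbC.
have xyE a b : (a, b) == (x, y) -> edge E a b by case/eqP=> -> ->.
rewrite /adjacent !edge_reversal (swap u v y x) (swap v u y x).
case: eqP (xyE u v) => [_ /(_ isT) ->|_ _]; first by rewrite !orbT.
by case: eqP (xyE v u) => [_ /(_ isT) ->|_ _]; rewrite ?orbT ?orbF.
Qed.

(** An immorality [x -> y <- w], or [y -> x <- w] after the reversal, would have
    [w] as a parent of both [x] and [y], hence adjacent to both. *)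
Lemma reversal_immoralities E r x y :
  topological E r -> covered E x y -> same_immoralities (reversal E x y) E.
Proof.
move=> rE [exy cov] u v w uw; rewrite (reversal_adjacent exy) => nuw.
have eyx := topological_asym rE exy.
have headE a b : collider E a v b -> ~~ adjacent E a b -> a != b ->
    (a, v) != (x, y).
  move=> /andP[eav ebv] nab ab; apply/eqP=> -[ax vy].
  move: nab; rewrite /adjacent ax -cov -1?vy ?ebv ?orbT // -ax eq_sym //.
have headR a b : collider (reversal E x y) a v b -> ~~ adjacent E a b ->
    a != b -> (a, v) != (y, x).
  move=> /andP[eav ebv] nab ab; apply/eqP=> -[ay vx].
  move: ebv; rewrite edge_reversal vx !xpair_eqE -ay eq_sym (negPf ab) /=.
  case/andP=> _ ebx; have bx := topological_neq rE ebx.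
  by move: nab; rewrite /adjacent ay (cov b bx) ebx orbT.
have colC G a b : collider G a v b = collider G b v a.
  by rewrite /collider andbC.
have wu : w != u by rewrite eq_sym.
have nwu : ~~ adjacent E w u by rewrite adjacent_sym.
apply/idP/idP=> c.
  have hu := headR u w c nuw uw; rewrite colC in c.
  have hw := headR w u c nwu wu; case/andP: c.
  rewrite /collider !edge_reversal (negPf hw) (negPf hu).
  by move=> /andP[_ ->] /andP[_ ->].
have hu := headE u w c nuw uw; rewrite colC in c.
have hw := headE w u c nwu wu; case/andP: c => ewv euv.
by rewrite /collider !edge_reversal hw hu euv ewv !orbT.
Qed.

(** Among the edges on which [E] and [F] disagree, take [x -> y] with [y] first
    and then [x] last in a topological order of [E]. A vertex other than [x]
    that is a parent of exactly one of [x] and [y] would produce an immorality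
    of one graph only, a cycle, or a later candidate for [x]. *)
Lemma exists_covered_edge E F r s :
    topological E r -> topological F s -> adjacent E =2 adjacent F ->
    same_immoralities E F -> E != F ->
  exists x y, covered E x y /\ edge F y x.
Proof.
move=> rE sF sk im nEF.
have flip u v : edge E u v -> ~~ edge F u v -> edge F v u.
  move=> euv nuv; have : adjacent F u v by rewrite -sk /adjacent euv.
  by rewrite /adjacent (negPf nuv).
pose diff u v := edge E u v && edge F v u.
have [[u v] /= duv] : exists uv : 'I_m * 'I_m, diff uv.1 uv.2.
  apply/existsP; apply: contraR nEF => /existsPn no; apply/eqP/setP=> -[u v].
  have EF a b : edge E a b -> edge F a b.
    move=> eab; have := no (a, b); rewrite /diff /= eab /=.
    by apply: contraNT => /(flip _ _ eab).
  apply/idP/idP=> [|fuv]; first exact: EF.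
  have : adjacent E u v by rewrite sk /adjacent /edge fuv.
  by case/orP=> // /EF; rewrite (topological_asym sF).
have dv : [exists w, diff w v] by apply/existsP; exists u.
have [y /existsP[x0 dx0] ymin] :=
  @arg_minnP _ v (fun z => [exists w, diff w z]) r dv.
have [x /andP[exy fyx] xmax] := @arg_maxnP _ x0 (diff^~ y) r dx0.
exists x, y; split=> //; split=> // z zx.
(* By the choice of y, the edges that end before y agree in E and F. *)
have agree a b : r b < r y -> edge E a b -> edge F a b.
  move=> rb eab; apply: contraTT rb => /(flip _ _ eab) fba.
  by rewrite -leqNgt; apply: ymin; apply/existsP; exists a; rewrite /diff eab.
have rxy := rE _ _ exy.
have nfxy := topological_asym sF fyx.
apply/idP/idP=> [ezy|ezx].
  apply: contraT => nzx.
  have azx : adjacent E z x.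
    apply: contraT => nazx.
    have := im z y x zx nazx; rewrite /collider ezy exy => /esym/andP[_].
    by rewrite nfxy.
  have exz : edge E x z by move: azx; rewrite /adjacent (negPf nzx).
  have fxz := agree _ _ (rE _ _ ezy) exz.
  have fyz : edge F y z.
    apply: contraT => nyz; have : adjacent F z y by rewrite -sk /adjacent ezy.
    rewrite /adjacent (negPf nyz) orbF => /sF; rewrite ltnNge => /negP[].
    exact/ltnW/(ltn_trans (sF _ _ fyx))/sF.
  have : r z <= r x by apply: xmax; rewrite /diff ezy.
  by rewrite leqNgt (rE _ _ exz).
apply: contraT => nzy; have fzx := agree _ _ rxy ezx.
have nyz : edge E y z = false.
  apply/negP=> /rE; rewrite ltnNge => /negP[].
  exact/ltnW/(ltn_trans (rE _ _ ezx)).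
have zy : z != y.
  by apply: contraTneq ezx => ->; rewrite (topological_asym rE exy).
have := im z x y zy; rewrite /adjacent (negPf nzy) nyz => /(_ isT).
by rewrite /collider fzx fyx (topological_asym rE exy) andbF.
Qed.

(** Chickering's theorem, in the form of an induction principle on the number of
    edges of [E] that are not edges of [F]. *)
Lemma covered_reversal_ind (P : {set 'I_m * 'I_m} -> Prop) :
    (forall E x y, acyclic E -> covered E x y -> P E -> P (reversal E x y)) ->
  forall E F, acyclic E -> acyclic F -> markov_equivalent E F -> P E -> P F.
Proof.
move=> step E F acE acF EF.
have [r rE] := acyclic_topological acE; have [s sF] := acyclic_topological acF.
have := markov_immoralities rE sF EF; have := markov_skeleton rE sF EF.
have [n] := ubnP #|E :\: F|.
elim: n E r acE rE {EF} => // n IHn E r acE rE le_n sk im PE.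
have [<- //|nEF] := eqVneq E F.
have [x [y [cov fyx]]] := exists_covered_edge rE sF sk im nEF.
have [exy _] := cov; have [r' rE'] := reversal_topological rE cov.
apply: (IHn (reversal E x y) r').
- exact: topological_acyclic rE'.
- exact: rE'.
- rewrite ltnS in le_n; apply: leq_trans le_n; apply: proper_card.
  apply/properP; split.
    apply/subsetP=> -[a b]; rewrite !inE => /andP[nF /orP[/eqP ab|/andP[_ ->]]].
      by move: nF; rewrite ab [_ \in F]fyx.
    by rewrite nF.
  exists (x, y); rewrite !inE.
    by rewrite [_ \in E]exy [_ \in F](topological_asym sF fyx).
  by rewrite eqxx xpair_eqE (negPf (topological_neq rE exy)) andbF.
- by move=> a b; rewrite reversal_adjacent.
- move=> u v w uw; rewrite (reversal_adjacent exy) => nuw.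
  rewrite (reversal_immoralities rE cov) // ?(reversal_adjacent exy) //.
  exact: im.
- exact: step.
Qed.
End Combinatorics.

Import GRing.Theory Num.Theory Order.TTheory.
Local Open Scope ring_scope.

(** * Rational functions and generic points *)

Section Rational.
Variables (R : realType) (n : nat) (S : set 'rV[R]_n).
Implicit Types (f g : 'rV[R]_n -> R).

Definition rational_on f := exists a b : {mpoly R[n]},
  forall x, S x -> b.@[x ord0] != 0 /\ f x * b.@[x ord0] = a.@[x ord0].

Lemma rational_on_cst c : rational_on (fun=> c).
Proof.
by exists c%:MP, 1 => x _; rewrite mevalC meval1 oner_neq0 mulr1.
Qed.

Lemma rational_on_coord i : rational_on (fun x => x ord0 i).
Proof.
by exists 'X_i, 1 => x _; rewrite mevalXU meval1 oner_neq0 mulr1.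
Qed.

Lemma eq_rational_on f g :
  (forall x, S x -> f x = g x) -> rational_on f -> rational_on g.
Proof.
move=> fg [a [b ab]]; exists a, b => x Sx.
by rewrite -fg //; exact: ab.
Qed.

Lemma rational_onD f g :
  rational_on f -> rational_on g -> rational_on (fun x => f x + g x).
Proof.
move=> [a [b ab]] [c [d cd]]; exists (a * d + c * b), (b * d) => x Sx.
have [b0 fb] := ab x Sx; have [d0 gd] := cd x Sx.
by rewrite !mevalD !mevalM mulf_neq0 // -fb -gd; split=> //; ring.
Qed.

Lemma rational_onM f g :
  rational_on f -> rational_on g -> rational_on (fun x => f x * g x).
Proof.
move=> [a [b ab]] [c [d cd]]; exists (a * c), (b * d) => x Sx.
have [b0 fb] := ab x Sx; have [d0 gd] := cd x Sx.
by rewrite !mevalM mulf_neq0 // -fb -gd; split=> //; ring.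
Qed.

Lemma rational_onN f : rational_on f -> rational_on (fun x => - f x).
Proof.
move=> rf; apply: eq_rational_on (rational_onM (rational_on_cst (-1)) rf).
by move=> x _; rewrite mulN1r.
Qed.

Lemma rational_onV f : (forall x, S x -> f x != 0) ->
  rational_on f -> rational_on (fun x => (f x)^-1).
Proof.
move=> f0 [a [b ab]]; exists b, a => x Sx.
have [b0 fb] := ab x Sx.
by rewrite -fb mulf_neq0 ?f0 // mulKf ?f0.
Qed.

Lemma rational_on_sum (I : Type) (r : seq I) (F : I -> 'rV[R]_n -> R) :
  (forall i, rational_on (F i)) -> rational_on (fun x => \sum_(i <- r) F i x).
Proof.
move=> rF; elim: r => [|i r IHr].
  by apply: eq_rational_on (rational_on_cst 0) => x _; rewrite big_nil.
by apply: eq_rational_on (rational_onD (rF i) IHr) => x _; rewrite big_cons.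
Qed.

Lemma rational_on_prod (I : Type) (r : seq I) (F : I -> 'rV[R]_n -> R) :
  (forall i, rational_on (F i)) -> rational_on (fun x => \prod_(i <- r) F i x).
Proof.
move=> rF; elim: r => [|i r IHr].
  by apply: eq_rational_on (rational_on_cst 1) => x _; rewrite big_nil.
by apply: eq_rational_on (rational_onM (rF i) IHr) => x _; rewrite big_cons.
Qed.

Lemma rational_onX f k : rational_on f -> rational_on (fun x => f x ^+ k).
Proof.
move=> rf; apply: eq_rational_on (rational_on_prod (iota 0 k) (fun=> rf)).
by move=> x _; rewrite big_const_seq count_predT size_iota iter_mulr_1.
Qed.

Lemma rational_on_meval k (p : {mpoly R[k]}) (F : 'rV[R]_n -> 'rV[R]_k) :
  (forall i, rational_on (fun x => F x ord0 i)) ->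
  rational_on (fun x => p.@[F x ord0]).
Proof.
move=> rF.
apply: (eq_rational_on (fun x _ => esym (mevalE (F x ord0) p))).
apply: rational_on_sum => j; apply: rational_onM; first exact: rational_on_cst.
by apply: rational_on_prod => i; apply: rational_onX.
Qed.

Definition mx_rational_on p q (A : 'rV[R]_n -> 'M[R]_(p, q)) :=
  forall i j, rational_on (fun x => A x i j).

Lemma mx_rational_on_cst p q (A : 'M[R]_(p, q)) : mx_rational_on (fun=> A).
Proof. by move=> i j; apply: rational_on_cst. Qed.

Lemma mx_rational_onM p q k
    (A : 'rV[R]_n -> 'M[R]_(p, q)) (B : 'rV[R]_n -> 'M[R]_(q, k)) :
  mx_rational_on A -> mx_rational_on B -> mx_rational_on (fun x => A x *m B x).
Proof.
move=> rA rB i j; apply: (@eq_rational_on (fun x => \sum_l A x i l * B x l j)).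
  by move=> x _; rewrite mxE.
by apply: rational_on_sum => l; apply: rational_onM.
Qed.

Lemma mx_rational_onD p q (A B : 'rV[R]_n -> 'M[R]_(p, q)) :
  mx_rational_on A -> mx_rational_on B -> mx_rational_on (fun x => A x + B x).
Proof.
move=> rA rB i j; apply: eq_rational_on (rational_onD (rA i j) (rB i j)).
by move=> x _; rewrite mxE.
Qed.

Lemma mx_rational_onN p q (A : 'rV[R]_n -> 'M[R]_(p, q)) :
  mx_rational_on A -> mx_rational_on (fun x => - A x).
Proof.
move=> rA i j; apply: eq_rational_on (rational_onN (rA i j)).
by move=> x _; rewrite mxE.
Qed.

Lemma mx_rational_onZ p q (f : 'rV[R]_n -> R) (A : 'rV[R]_n -> 'M[R]_(p, q)) :
  rational_on f -> mx_rational_on A -> mx_rational_on (fun x => f x *: A x).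
Proof.
move=> rf rA i j; apply: eq_rational_on (rational_onM rf (rA i j)).
by move=> x _; rewrite mxE.
Qed.

Lemma mx_rational_on_tr p q (A : 'rV[R]_n -> 'M[R]_(p, q)) :
  mx_rational_on A -> mx_rational_on (fun x => (A x)^T).
Proof.
by move=> rA i j; apply: eq_rational_on (rA j i) => x _; rewrite mxE.
Qed.

End Rational.

(** On the line [x + t (1, ..., 1)] the polynomial [p] is a nonzero polynomial
    in [t], which has finitely many roots. *)
Lemma meval_shift_neq0 (R : realType) n (p : {mpoly R[n]})
    (x : 'rV[R]_n) (B : R) :
  p.@[x ord0] != 0 -> exists2 t, B < t & p.@[(x + const_mx t) ord0] != 0.
Proof.
move=> px.
pose g : {poly R} :=
  \sum_(c <- msupp p) p@_c *: \prod_i ((x ord0 i)%:P + 'X) ^+ c i.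
have gE t : g.[t] = p.@[(x + const_mx t) ord0].
  rewrite mevalE horner_sum; apply: eq_bigr => c _; rewrite hornerZ horner_prod.
  by congr (_ * _); apply: eq_bigr => i _; rewrite !mxE !hornerE.
have g0 : g != 0.
  have x0 : x + const_mx 0 = x by apply/rowP=> i; rewrite !mxE addr0.
  by apply: contraNneq px => g0; rewrite -[x]x0 -gE g0 horner0.
pose s := [seq B + k.+1%:R | k <- iota 0 (size g)].
have /allPn[t /mapP[k _ ->] nr] : ~~ all (root g) s.
  have us : uniq s.
    rewrite map_inj_uniq ?iota_uniq // => a b /addrI/eqP.
    by rewrite eqr_nat => /eqP[].
  apply/negP=> rs; have := max_poly_roots g0 rs us.
  by rewrite size_map size_iota ltnn.
exists (B + k.+1%:R); first by rewrite ltrDl ltr0n.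
by rewrite -gE.
Qed.

(** * Transport of generic finiteness *)

Section Reparametrize.
Variables (R : realType) (m : nat).
Implicit Types (E F : {set 'I_m * 'I_m}) (t : params R m).

Definition vec_of_params E t : 'rV[R]_(m + m + #|E|) :=
  row_mx (row_mx (\row_i t.1.2 i i) t.2^T)
         (\row_k t.1.1 (enum_val k).1 (enum_val k).2).

Lemma params_of_vecK E : cancel (@params_of_vec R m E) (@vec_of_params E).
Proof.
move=> x; rewrite -[RHS]hsubmxK -[lsubmx x]hsubmxK /vec_of_params.
congr (row_mx (row_mx _ _) _).
- by apply/rowP=> i; rewrite !mxE eqxx mulr1n.
- by rewrite /= trmxK.
- by apply/rowP=> k; rewrite mxE params_of_vec_edge.
Qed.

Lemma vec_of_paramsK E t :
  Theta R m E t -> params_of_vec (vec_of_params E t) = t.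
Proof.
have [_ _ sur] := Theta_vec_bij R E.
by move=> /sur[x _ <-]; rewrite params_of_vecK.
Qed.

Lemma Theta_vec_pos E (x : 'rV[R]_(m + m + #|E|)) :
  (forall i, 0 < x ord0 i) -> Theta_vec R m E x.
Proof.
move=> x0; split=> /=.
- move=> w v wvE; rewrite summxE big1 // => k _; rewrite !mxE.
  case: andP => [[/eqP e1 /eqP e2]|_]; last by rewrite mulr0.
  by move: wvE; rewrite e1 e2 -surjective_pairing enum_valP.
- exact: diag_mx_is_diag.
- by move=> v; rewrite !mxE eqxx mulr1n x0.
Qed.

(** The parameter space is Zariski dense: it contains all positive vectors, and
    every line in the direction [(1, ..., 1)] reaches those. *)
Lemma meval_Theta_vec_neq0 E (p : {mpoly R[m + m + #|E|]})
    (x : 'rV[R]_(m + m + #|E|)) :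
  p.@[x ord0] != 0 -> exists2 z, Theta_vec R m E z & p.@[z ord0] != 0.
Proof.
move=> px; have [t tB pt] := meval_shift_neq0 (\sum_i `|x ord0 i|) px.
exists (x + const_mx t) => //; apply: Theta_vec_pos => i.
rewrite !mxE -ltrBlDl sub0r; apply: le_lt_trans tB.
rewrite (bigD1 i) //= (le_trans (ler_norm _)) // normrN lerDl.
by apply: sumr_ge0 => j _; exact: normr_ge0.
Qed.

(** If the zero set of [p] contains the exceptional points for [E], then the
    zero set of the numerator of [p] composed with [f] contains those for [F].
    This numerator is not zero because [f] is onto and [p] does not vanish on
    all of [Theta E]. *)
Lemma identifiable_reparametrize E F (f g : params R m -> params R m) :
    (forall t, Theta R m F t -> Theta R m E (f t)) ->
    (forall t, Theta R m E t -> Theta R m F (g t)) ->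
    (forall t, Theta R m F t -> g (f t) = t) ->
    (forall t, Theta R m E t -> f (g t) = t) ->
    (forall t, Theta R m F t -> phi (f t) = phi t) ->
    (forall i, rational_on (Theta_vec R m F)
       (fun x => vec_of_params E (f (params_of_vec x)) ord0 i)) ->
  generically_finitely_identifiable R m E ->
  generically_finitely_identifiable R m F.
Proof.
move=> fF gE gf fg phif rf [S' [[ps ->] ST fin]].
pose psi x := vec_of_params E (f (@params_of_vec R m F x)).
have psiE x : Theta_vec R m F x -> params_of_vec (psi x) = f (params_of_vec x).
  by move=> Fx; rewrite vec_of_paramsK //; exact: fF.
have psiT x : Theta_vec R m F x -> Theta_vec R m E (psi x).
  by move=> Fx; rewrite /Theta_vec /= psiE //; exact: fF.
have [p pps [x px]] : exists2 p, p \in ps &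
    exists x : 'rV[R]_(m + m + #|E|), p.@[x ord0] != 0.
  apply: contrapT => no; apply: ST; apply/seteqP; split=> // x _ p pps.
  apply/eqP; apply: contrapT => /negP px; apply: no.
  by exists p => //; exists x.
have [z Ez pz] := meval_Theta_vec_neq0 px.
have [a [b ab]] := rational_on_meval p rf.
exists [set x | forall q, q \in [:: a] -> q.@[x ord0] = 0]%classic; split.
- by exists [:: a].
- move=> aT; have Fg := gE _ Ez.
  pose y := vec_of_params F (g (params_of_vec z)).
  have Fy : Theta_vec R m F y by rewrite /Theta_vec /= vec_of_paramsK.
  have [b0 pab] := ab y Fy.
  have ay : a.@[y ord0] = 0.
    have : [set: 'rV[R]_(m + m + #|F|)]%classic y by [].
    by rewrite -aT => /(_ a (mem_head _ _)).
  move: pab; rewrite ay => /eqP; rewrite mulf_eq0 (negPf b0) orbF.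
  by rewrite vec_of_paramsK // fg // params_of_vecK (negPf pz).
- move=> s [Fs nas].
  have fin_s : finite_set [set s' | Theta_vec R m E s' /\
      phi (params_of_vec s') = phi (params_of_vec (psi s))]%classic.
    apply: fin; split; first exact: psiT.
    move=> /(_ p pps) ps0; apply: nas => q; rewrite inE => /eqP ->.
    by have [_ <-] := ab s Fs; rewrite ps0 mul0r.
  apply: sub_finite_set (finite_image
    (fun x => vec_of_params F (g (params_of_vec x))) fin_s).
  move=> s' [Fs' es']; exists (psi s').
    by split; [exact: psiT | rewrite !psiE // !phif].
  by rewrite psiE // gf // params_of_vecK.
Qed.
End Reparametrize.

(** * The reparametrization of a reversed covered edge *)

Section Elementary.
Variables (R : comNzRingType) (m : nat).
Implicit Types (x y : 'I_m) (c : R) (A : 'M[R]_m).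

Definition elem_mx x y c : 'M[R]_m := 1%:M + c *: delta_mx x y.

Lemma elem_mulmxE n x y c (A : 'M[R]_(m, n)) u v :
  (elem_mx x y c *m A) u v = A u v + (u == x)%:R * (c * A y v).
Proof.
rewrite mulmxDl mul1mx -scalemxAl !mxE; congr (_ + _).
rewrite (bigD1 y) //= !mxE eqxx andbT big1 => [|k ky].
  by rewrite addr0; case: (u == x); rewrite ?mul1r // ?mul0r mulr0.
by rewrite !mxE (negPf ky) andbF mul0r.
Qed.

Lemma elem_mulmxN x y c : x != y -> elem_mx x y c *m elem_mx x y (- c) = 1%:M.
Proof.
move=> xy; rewrite mulmxDl mul1mx mulmxDr mulmx1 -scalemxAl -scalemxAr.
rewrite mul_delta_mx_0 1?eq_sym // !scaler0 addr0 -addrA.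
by rewrite scaleNr addNr addr0.
Qed.

Lemma mulmx_elem_trE n x y c (A : 'M[R]_(n, m)) u v :
  (A *m (elem_mx x y c)^T) u v = A u v + (v == x)%:R * (c * A u y).
Proof.
by rewrite -[A in LHS]trmxK -trmx_mul mxE elem_mulmxE !mxE.
Qed.

End Elementary.

(** In a left kernel vector [w], which satisfies [w = w L], the entry at [v] is
    a combination of the entries at the parents of [v], so all entries vanish by
    induction along the topological order. *)
Lemma unitmx_1sub_acyclic (R : realType) m (E : {set 'I_m * 'I_m}) r
    (L : 'M[R]_m) :
  topological E r -> (forall u v, (u, v) \notin E -> L u v = 0) ->
  1%:M - L \in unitmx.
Proof.
move=> rE L0; rewrite -row_free_unit -kermx_eq0; apply/eqP/row_matrixP=> i.
rewrite row0; set w := row i _.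
have wL : w = w *m L.
  apply/eqP; rewrite -subr_eq0 -{1}[w]mulmx1 -mulmxBr -row_mul.
  by rewrite mulmx_ker row0.
apply/rowP=> v; rewrite [RHS]mxE.
have [n] := ubnP (r v); elim: n v => // n IHn v rv.
rewrite wL mxE big1 // => u _; have [uv|uv] := boolP ((u, v) \in E).
  by rewrite IHn ?mul0r //; exact: leq_trans (rE _ _ uv) rv.
by rewrite L0 ?mulr0.
Qed.

Section Reversal.
Variables (R : realType) (m : nat).
Implicit Types (E : {set 'I_m * 'I_m}) (x y : 'I_m) (t : params R m).

(** The variance of [X_y] given the latent variable and the common parents of
    [x] and [y]. *)
Definition child_var x y t : R := t.1.2 y y + t.1.1 x y ^+ 2 * t.1.2 x x.

(** The coefficient of [X_y] in the regression of [X_x] on [X_y], the latent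
    variable and the common parents. *)
Definition regression_coef x y t : R :=
  t.1.1 x y * t.1.2 x x / child_var x y t.

(** The right factor substitutes the equation of [x] into that of [y], which
    removes [X_x] from the latter; the left factor subtracts from the equation
    of [x] the multiple of the new equation of [y] that makes the noises
    uncorrelated. *)
Definition reversal_mx x y t : 'M[R]_m :=
  elem_mx x y (- regression_coef x y t) *m elem_mx y x (t.1.1 x y).

Definition reverse_params x y t : params R m :=
  let P := reversal_mx x y t in
  (1%:M - (1%:M - t.1.1) *m P^T, P *m t.1.2 *m P^T, P *m t.2).

(** Multiplying the structural equations by an invertible matrix does not change
    their solution. *)
Lemma phi_mulmx (P : 'M[R]_m) t : P \in unitmx -> 1%:M - t.1.1 \in unitmx ->
  phi (1%:M - (1%:M - t.1.1) *m P^T, P *m t.1.2 *m P^T, P *m t.2) = phi t.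
Proof.
case: t => [[L O] d] /= uP uL.
have uLT : 1%:M - L^T \in unitmx by rewrite -[1%:M]trmx1 -linearB unitmx_tr.
have uPT : P^T \in unitmx by rewrite unitmx_tr.
have -> : 1%:M - (1%:M - (1%:M - L) *m P^T) = (1%:M - L) *m P^T.
  by rewrite subKr.
have -> : 1%:M - (1%:M - (1%:M - L) *m P^T)^T = P *m (1%:M - L^T).
  have trB (A B : 'M[R]_m) : (A - B)^T = A^T - B^T by exact: linearB.
  by rewrite trB trmx1 trmx_mul trmxK trB trmx1 subKr.
have -> : P *m O *m P^T + P *m d *m (P *m d)^T = P *m (O + d *m d^T) *m P^T.
  by rewrite trmx_mul mulmxDr mulmxDl !mulmxA.
have inv_mul (A B : 'M[R]_m) : A \in unitmx -> B \in unitmx ->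
    invmx (A *m B) = invmx B *m invmx A.
  move=> uA uB; have uAB : A *m B \in unitmx by rewrite unitmx_mul uA.
  apply: (can_inj (mulKmx uAB)).
  by rewrite mulmxV // !mulmxA mulmxK // mulmxV.
rewrite !inv_mul // -!mulmxA (mulKmx uP).
by rewrite (mulKVmx uPT).
Qed.

Lemma elem_mx_unit x y c : x != y -> elem_mx x y c \in @unitmx R m.
Proof. by move=> xy; have /mulmx1_unit[] := elem_mulmxN c xy. Qed.

Lemma reversal_mx_unit x y t : x != y -> reversal_mx x y t \in unitmx.
Proof. by move=> xy; rewrite unitmx_mul !elem_mx_unit // eq_sym. Qed.

Lemma reverse_params_phi E r x y t :
  topological E r -> x != y -> Theta R m E t ->
  phi (reverse_params x y t) = phi t.
Proof.
move=> rE xy [L0 _ _]; apply: phi_mulmx; first exact: reversal_mx_unit.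
exact: unitmx_1sub_acyclic rE L0.
Qed.

Lemma child_var_gt0 E x y t : Theta R m E t -> 0 < child_var x y t.
Proof.
by case=> _ _ Op; rewrite ltr_wpDr // mulr_ge0 ?sqr_ge0 // ltW.
Qed.

Lemma reverse_params_edgeE x y t u v :
  (reverse_params x y t).1.1 u v =
  (u == v)%:R - ((u == v)%:R - t.1.1 u v
    + (v == y)%:R * (t.1.1 x y * ((u == x)%:R - t.1.1 u x))
    + (v == x)%:R * (- regression_coef x y t *
        ((u == y)%:R - t.1.1 u y + t.1.1 x y * ((u == x)%:R - t.1.1 u x)))).
Proof.
rewrite /= [LHS]mxE [in LHS]mxE [X in _ + X]mxE trmx_mul mulmxA !mulmx_elem_trE.
by rewrite eqxx !mul1r !mxE.
Qed.

Lemma reverse_params_noiseE x y t u v :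
  x != y -> is_diag_mx t.1.2 ->
  let k := regression_coef x y t in let l := t.1.1 x y in
  let a := t.1.2 x x in let b := t.1.2 y y in
  (reverse_params x y t).1.2 u v =
  if u == x then
    if v == x then (1 - k * l) ^+ 2 * a + k ^+ 2 * b
    else if v == y then (1 - k * l) * l * a - k * b else 0
  else if u == y then
    if v == y then b + l ^+ 2 * a
    else if v == x then (1 - k * l) * l * a - k * b else 0
  else t.1.2 u v.
Proof.
move=> xy /is_diag_mxP O0 k l a b.
have Od i j : i != j -> t.1.2 i j = 0 by exact: O0.
have yx : y != x by rewrite eq_sym.
rewrite /= trmx_mul !mulmxA !mulmx_elem_trE -!mulmxA !elem_mulmxE -/k -/l.
have [->|ux] := eqVneq u x; last have [->|uy] := eqVneq u y;
  (have [->|vx] := eqVneq v x; last have [->|vy] := eqVneq v y);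
  rewrite ?eqxx ?(negPf xy) ?(negPf yx) -/a -/b
    ?(Od x y) ?(Od y x) ?(Od x v) ?(Od y v) ?(Od u x) ?(Od u y) //;
  rewrite 1?eq_sym //;
  by rewrite ?(mulr0n, mulr1n) /=; ring.
Qed.

(** Each new equation involves the parents of both [x] and [y], so it respects
    the reversed graph because the edge is covered. *)
Lemma reverse_params_Theta E r x y t :
  topological E r -> covered E x y -> Theta R m E t ->
  Theta R m (reversal E x y) (reverse_params x y t).
Proof.
move=> rE [exy cov] tE; have [L0 Od Op] := tE.
have xy := topological_neq rE exy.
have yx : y != x by rewrite eq_sym.
have nL u v : ~~ edge E u v -> t.1.1 u v = 0 by exact: L0.
have Lyx : t.1.1 y x = 0 by apply: nL; rewrite (topological_asym rE exy).
have Lv v : t.1.1 v v = 0 by apply: nL; rewrite (topological_irr _ rE).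
have s0 := child_var_gt0 x y tE.
have := lt0r_neq0 s0; rewrite /child_var => s1.
split.
- move=> u v; rewrite -[_ \in _]/(edge _ u v) edge_reversal !xpair_eqE.
  rewrite reverse_params_edgeE.
  have [->|vy] := eqVneq v y.
    rewrite (negPf yx) !andbF !andbT /= mul1r mul0r addr0.
    have [-> _|ux] := eqVneq u x; last first.
      move=> /= nuy; have nux : ~~ edge E u x by rewrite -cov.
      by rewrite (nL _ _ nuy) (nL _ _ nux) mulr0n ?mulr1n; ring.
    by rewrite (negPf xy) Lv mulr0n mulr1n; ring.
  rewrite !andbF mul0r addr0 /=; have [->|vx] := eqVneq v x.
    rewrite andbT negb_or => /andP[uy nux]; rewrite (negPf uy) (nL _ _ nux).
    have [->|ux] := eqVneq u x.
      by rewrite ?(eqxx, mulr0n, mulr1n, negPf xy); ring.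
    by rewrite (nL u y) ?cov // ?mulr0n; ring.
  rewrite andbF /= mul0r => /nL ->; ring.
- apply/is_diag_mxP=> u v nuv; rewrite reverse_params_noiseE //.
  have uv : u != v by exact: nuv.
  (* The coefficient of the regression is the one that makes this vanish. *)
  have off : (1 - regression_coef x y t * t.1.1 x y) * t.1.1 x y * t.1.2 x x
     - regression_coef x y t * t.1.2 y y = 0.
    by rewrite /regression_coef /child_var; field.
  have [ux|ux] := eqVneq u x.
    rewrite -ux eq_sym (negPf uv).
    by case: ifP => //; rewrite ux off.
  have [uy|uy] := eqVneq u y.
    rewrite -uy eq_sym (negPf uv).
    by case: ifP => //; rewrite uy off.
  by move/is_diag_mxP: Od; apply.
- move=> v; rewrite reverse_params_noiseE //.
  have [_|vx] := eqVneq v x.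
    have -> : (1 - regression_coef x y t * t.1.1 x y) ^+ 2 * t.1.2 x x +
        regression_coef x y t ^+ 2 * t.1.2 y y =
        t.1.2 x x * t.1.2 y y / (t.1.2 y y + t.1.1 x y ^+ 2 * t.1.2 x x).
      by rewrite /regression_coef /child_var; field.
    by rewrite divr_gt0 // mulr_gt0.
  by have [_|vy] := eqVneq v y.
Qed.

(** The two parameters of [reversal_mx] trade places: the new weight of [y -> x]
    is the old regression coefficient, and conversely. Hence the two row
    operations are inverse to each other. *)
Lemma reverse_paramsK E r x y t :
  topological E r -> covered E x y -> Theta R m E t ->
  reverse_params y x (reverse_params x y t) = t.
Proof.
move=> rE [exy cov] tE; have [L0 Od Op] := tE.
have xy := topological_neq rE exy.
have yx : y != x by rewrite eq_sym.
have nL u v : ~~ edge E u v -> t.1.1 u v = 0 by exact: L0.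
have Lyx : t.1.1 y x = 0 by apply: nL; rewrite (topological_asym rE exy).
have Lv v : t.1.1 v v = 0 by apply: nL; rewrite (topological_irr _ rE).
have s0 := child_var_gt0 x y tE.
have := lt0r_neq0 s0; rewrite /child_var => s1.
have Ox := lt0r_neq0 (Op x).
have l' : (reverse_params x y t).1.1 y x = regression_coef x y t.
  rewrite reverse_params_edgeE !eqxx (negPf xy) (negPf yx) Lyx Lv.
  by rewrite ?mulr0n ?mulr1n; ring.
have k' : regression_coef y x (reverse_params x y t) = t.1.1 x y.
  rewrite {1}/regression_coef {1}/child_var.
  rewrite l' !reverse_params_noiseE // !eqxx (negPf yx).
  rewrite /regression_coef /child_var; field; rewrite s1 /=.
  rewrite [X in X != 0](_ : _ =
    t.1.2 x x * (t.1.2 y y + t.1.1 x y ^+ 2 * t.1.2 x x) ^+ 2); last by ring.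
  by rewrite mulf_neq0 // expf_neq0.
have PP : reversal_mx y x (reverse_params x y t) *m reversal_mx x y t = 1%:M.
  rewrite /reversal_mx l' k' mulmxA -(mulmxA (elem_mx y x _)) elem_mulmxN //.
  by rewrite mulmx1 -{2}[t.1.1 x y]opprK elem_mulmxN.
have PPT :
    (reversal_mx x y t)^T *m (reversal_mx y x (reverse_params x y t))^T = 1%:M.
  by rewrite -trmx_mul PP trmx1.
rewrite /reverse_params -/(reverse_params x y t) /=.
move: (reversal_mx y x _) (reversal_mx x y t) PP PPT => Q P PP PPT.
rewrite subKr -!mulmxA PPT !mulmx1 subKr !(mulmxA Q) PP !mul1mx.
by case: (t) => [[]].
Qed.

Lemma reversalK E x y : edge E x y -> ~~ edge E y x ->
  reversal (reversal E x y) y x = E.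
Proof.
rewrite /edge => exy neyx; apply/setP=> e; rewrite !inE.
have [->|exy'] := eqVneq e (x, y); first by rewrite exy.
by have [->|] := eqVneq e (y, x); rewrite ?(negPf neyx).
Qed.

Lemma reversal_covered E r x y :
  topological E r -> covered E x y -> covered (reversal E x y) y x.
Proof.
move=> rE [exy cov]; split; first by rewrite edge_reversal eqxx.
have xy := negPf (topological_neq rE exy).
move=> z zy; rewrite !edge_reversal !xpair_eqE (negPf zy) xy andbF.
rewrite eqxx andbT /=.
have [->|zx] := eqVneq z x; last by rewrite cov.
by rewrite (topological_irr _ rE) eqxx.
Qed.

Lemma rational_reverse_params E F x y :
  forall i, rational_on (Theta_vec R m F)
    (fun z => vec_of_params E (reverse_params x y (params_of_vec z)) ord0 i).
Proof.
pose rat := @mx_rational_on R (m + m + #|F|) (Theta_vec R m F).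
have rD : rat _ _ (fun z => (params_of_vec z).2).
  move=> i j.
  apply: eq_rational_on (rational_on_coord _ (lshift _ (rshift _ i))).
  by move=> z _; rewrite !mxE (ord1 j).
have rO : rat _ _ (fun z => (params_of_vec z).1.2).
  move=> i j; apply: (@eq_rational_on _ _ _
    (fun z => z ord0 (lshift _ (lshift _ i)) * (i == j)%:R)).
    by move=> z _; rewrite !mxE mulr_natr.
  by apply: rational_onM; [exact: rational_on_coord | exact: rational_on_cst].
have rL : rat _ _ (fun z => (params_of_vec z).1.1).
  move=> i j; apply: (@eq_rational_on _ _ _ (fun z => \sum_(k < #|F|)
    z ord0 (rshift _ k) * delta_mx (enum_val k).1 (enum_val k).2 i j)).
    by move=> z _; rewrite /= summxE; apply: eq_bigr => k _; rewrite !mxE.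
  apply: rational_on_sum => k.
  by apply: rational_onM; [exact: rational_on_coord | exact: rational_on_cst].
have relem i j f : rational_on (Theta_vec R m F) f ->
    rat _ _ (fun z => elem_mx i j (f z)).
  move=> rf; apply: mx_rational_onD; first exact: mx_rational_on_cst.
  by apply: mx_rational_onZ => //; exact: mx_rational_on_cst.
have rk : rational_on (Theta_vec R m F)
    (fun z => regression_coef x y (params_of_vec z)).
  apply: rational_onM; first by apply: rational_onM; [exact: rL|exact: rO].
  apply: rational_onV => [z Fz|].
    exact: lt0r_neq0 (child_var_gt0 x y Fz).
  apply: rational_onD; first exact: rO.
  by apply: rational_onM; [apply: rational_onX; exact: rL|exact: rO].
have rP : rat _ _ (fun z => reversal_mx x y (params_of_vec z)).
  by apply: mx_rational_onM; apply: relem; [exact: rational_onN|exact: rL].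
have rPT := mx_rational_on_tr rP.
have rN : rat _ _ (fun z => 1%:M - (params_of_vec z).1.1).
  apply: mx_rational_onD; first exact: mx_rational_on_cst.
  exact: mx_rational_onN.
have rD' := mx_rational_onM rP rD.
have rO' := mx_rational_onM (mx_rational_onM rP rO) rPT.
have rL' : rat _ _ (fun z => (reverse_params x y (params_of_vec z)).1.1).
  apply: mx_rational_onD; first exact: mx_rational_on_cst.
  by apply: mx_rational_onN; exact: mx_rational_onM.
move=> i; case: (split_ordP i) => [j ->|k ->]; last first.
  apply: eq_rational_on (rL' (enum_val k).1 (enum_val k).2) => z _.
  by rewrite /vec_of_params row_mxEr [RHS]mxE.
case: (split_ordP j) => [k ->|k ->].
  apply: eq_rational_on (rO' k k) => z _.
  by rewrite /vec_of_params !row_mxEl [RHS]mxE.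
apply: eq_rational_on (rD' k ord0) => z _.
by rewrite /vec_of_params row_mxEl row_mxEr [RHS]mxE.
Qed.

Lemma identifiable_reversal E x y :
  acyclic E -> covered E x y ->
  generically_finitely_identifiable R m E ->
  generically_finitely_identifiable R m (reversal E x y).
Proof.
move=> acE cov; have [r rE] := acyclic_topological acE.
have [r' rE'] := reversal_topological rE cov.
have cov' := reversal_covered rE cov; have [exy _] := cov.
have neyx : ~~ edge E y x by rewrite (topological_asym rE exy).
have xy := topological_neq rE exy.
have EK := reversalK exy neyx.
apply: (identifiable_reparametrize (f := reverse_params y x)
                                   (g := reverse_params x y)).
- by move=> t Et; rewrite -EK; exact: reverse_params_Theta rE' cov' Et.
- by move=> t Et; exact: reverse_params_Theta rE cov Et.
- by move=> t Et; exact: reverse_paramsK rE' cov' Et.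
- by move=> t Et; exact: reverse_paramsK rE cov Et.
- by move=> t; apply: reverse_params_phi rE' _; rewrite eq_sym.
- exact: rational_reverse_params.
Qed.
End Reversal.

(** * Markov equivalence and identifiability *)

Theorem theorem1p5 (R : realType) (m : nat) (E1 E2 : {set 'I_m * 'I_m})
    (acyclic1 : acyclic E1) (acyclic2 : acyclic E2)
    (equiv12 : markov_equivalent E1 E2) :
  generically_finitely_identifiable R m E1 <->
  generically_finitely_identifiable R m E2.
Proof.
have rev := @identifiable_reversal R m.
split; first exact: (covered_reversal_ind rev acyclic1 acyclic2 equiv12).
have equiv21 := markov_equivalentC equiv12.
exact: (covered_reversal_ind rev acyclic2 acyclic1 equiv21).
Qed.
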